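(* Every graph $H$ is the $\gamma_{ID}$-graph of some graph; that is, for every graph $H$ there exists a graph $G$ with $G(\gamma_{ID})\cong H$.
   Context: For a graph $G$, a set $S\subseteq V(G)$ is an identifying code if for every $v\in V(G)$ the set $N[v]\cap S$ is nonempty and these sets are pairwise distinct over all vertices $v$. $\gamma_{ID}(G)$ is the minimum cardinality of an identifying code, and a $\gamma_{ID}$-set is an identifying code of that cardinality. The $\gamma_{ID}$-graph $G(\gamma_{ID})$ has one vertex for each $\gamma_{ID}$-set of $G$, and the vertices corresponding to $S_u,S_w$ are adjacent iff there exist $u'\in S_u$, $w'\in S_w$ with $u'w'\in E(G)$ and $S_w=(S_u-\{u'\})\cup\{w'\}$. *)

(* Defs.v *)
From mathcomp Require Import all_boot.

Set Implicit Arguments.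
Unset Strict Implicit.
Unset Printing Implicit Defensive.

(* Finite simple graphs. *)
Record sgraph := SGraph {
  vertex :> finType;
  edge : rel vertex;
  edge_sym : symmetric edge;
  edge_irr : irreflexive edge
}.

Definition sgraph_iso (G H : sgraph) : Prop :=
  exists2 f : G -> H, bijective f & forall x y, edge (f x) (f y) = edge x y.

Section IdentifyingCodes.

Variable G : sgraph.
Implicit Types (v : G) (S : {set G}).

Definition closed_neigh v : {set G} := [set w | (w == v) || edge v w].

Definition id_code S : bool :=
  [forall v, closed_neigh v :&: S != set0] &&
  [forall v, forall w, (v != w) ==>
     (closed_neigh v :&: S != closed_neigh w :&: S)].

(* If G has an identifying code at all then setT is one (id_code_setT), so the
   minimum is genuine (gammaID_le, gammaID_attained).  If G has none, gammaID
   is the junk value #|G|, and G has no gammaID-set. *)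
Definition gammaID : nat := #|[arg min_(S < setT | id_code S) #|S|]|.

Definition gammaID_set S : bool := id_code S && (#|S| == gammaID).

Lemma id_codeS S S' : S \subset S' -> id_code S -> id_code S'.
Proof.
move=> sSS' /andP[/forallP dom /forallP sep].
have IS v : closed_neigh v :&: S = (closed_neigh v :&: S') :&: S.
  by rewrite -setIA (setIidPr sSS').
apply/andP; split; apply/forallP => v.
  by apply: contraNneq (dom v) => NS'0; rewrite IS NS'0 set0I.
apply/forallP => w; apply/implyP => neq_vw.
have /implyP/(_ neq_vw) := forallP (sep v) w.
by apply: contraNneq => eqN; rewrite !IS eqN.
Qed.

Lemma id_code_setT S : id_code S -> id_code setT.
Proof. exact/id_codeS/subsetT. Qed.

Lemma gammaID_le S : id_code S -> gammaID <= #|S|.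
Proof.
move=> idS; rewrite /gammaID.
by case: arg_minnP => [|S0 _]; [apply: id_code_setT idS | apply].
Qed.

Lemma gammaID_attained S : id_code S -> exists S0, gammaID_set S0.
Proof.
move=> idS; exists [arg min_(S < setT | id_code S) #|S|].
rewrite /gammaID_set eqxx andbT.
by case: arg_minnP => //; apply: id_code_setT idS.
Qed.

Definition gammaID_vertex : finType := {S : {set G} | gammaID_set S}.

Definition gammaID_edge : rel gammaID_vertex := fun A B =>
  [exists u in val A, exists w in val B,
     edge u w && (val B == (val A :\ u) :|: [set w])].

Lemma gammaID_edge_irr : irreflexive gammaID_edge.
Proof.
move=> A; apply/negbTE/negP => /exists_inP[u uA /exists_inP[w _ /andP[uw /eqP eqA]]].
move: uA; rewrite {1}eqA !inE eqxx /= => /eqP eq_uw.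
by move: uw; rewrite eq_uw edge_irr.
Qed.

Lemma gammaID_edge_sym : symmetric gammaID_edge.
Proof.
suff sub A B : gammaID_edge A B -> gammaID_edge B A.
  by move=> A B; apply/idP/idP; apply: sub.
move=> /exists_inP[u uA /exists_inP[w wB /andP[uw /eqP eqB]]].
have wNA : w \notin val A :\ u.
  apply/negP => wA.
  have /eqP cA := proj2 (andP (valP A)); have /eqP cB := proj2 (andP (valP B)).
  move: cA; rewrite -cB eqB setUC (setUidPr _) ?sub1set //.
  by rewrite (cardsD1 u) uA /= add1n => /esym/n_Sn.
apply/exists_inP; exists w => //; apply/exists_inP; exists u => //.
by rewrite edge_sym uw eqB (setUC _ [set w]) setU1K // setUC setD1K /=.
Qed.

Definition gammaID_graph : sgraph := SGraph gammaID_edge_sym gammaID_edge_irr.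

End IdentifyingCodes.

(* Main.v *)
(* The graph G is H together with a set F of forced vertices and a clique.  The
   F-neighbourhoods of the clique vertices are F (for two vertices p and q) and
   F minus f (for one vertex a_f per f in F).  Separating a_f from q forces f
   into every identifying code.  Only p is joined to the copy of H, so that
   separating p from q forces a vertex of H into every code.  Conversely F
   separates and dominates everything but the pair p, q, because the vertices of
   F, of H, the a_f and p, q have F-neighbourhoods of sizes 1, 2, |F| - 1 and |F|.
   Hence the minimum codes are the sets F + v with v in H. *)
Require Import Defs.
From mathcomp Require Import all_boot.
From mathcomp Require Import zify.

Set Implicit Arguments.
Unset Strict Implicit.
Unset Printing Implicit Defensive.

Section IdCodeTheory.

Variable G : sgraph.
Implicit Types (v w : G) (S : {set G}).

Lemma id_code_sep S v w : id_code S -> v != w ->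
  exists2 s, s \in S & (s \in closed_neigh v) != (s \in closed_neigh w).
Proof.
move=> /andP[_ /forallP/(_ v)/forallP/(_ w)/implyP sep] /sep neqN.
apply/exists_inP; apply: contraNT neqN; rewrite negb_exists_in => /forall_inP eqN.
apply/eqP/setP => s; rewrite !inE; case: (boolP (s \in S)) => [sS|]; last by rewrite !andbF.
by move: (eqN s sS); rewrite negbK !inE => /eqP->.
Qed.

Lemma id_codeP S :
    (forall v, exists2 s, s \in S & s \in closed_neigh v) ->
    (forall v w, {in S, closed_neigh v =i closed_neigh w} -> v = w) ->
  id_code S.
Proof.
move=> dom sep; apply/andP; split; apply/forallP => v.
  by have [s sS sv] := dom v; apply/set0Pn; exists s; rewrite inE sv.
apply/forallP => w; apply/implyP; apply: contraNneq => eqN; apply/eqP/sep => s sS.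
by have := congr1 (fun A : {set G} => s \in A) eqN; rewrite !inE sS !andbT.
Qed.

End IdCodeTheory.

Section Construction.

Variable H : sgraph.

(** The four extra elements make the sizes 1, 2, |F| - 1 and |F| distinct even when [H] is empty. *)
Let F : finType := (H + 'I_4)%type.
Let T : finType := (H + F + option (option F))%type.

Let copy (v : H) : T := inl (inl v).
Let forced (f : F) : T := inl (inr f).

(** The shared element [inr ord0] raises the size to 2, which keeps [copy v] apart from
    [forced (inl v)]. *)
Let link (v : H) : {set F} := [set inl v; inr ord0].

(* In the clique, [None] is p, [Some None] is q and [Some (Some f)] is a_f. *)
Definition gadget_edge : rel T := fun y z =>
  match y, z with
  | inl (inl u), inl (inl w) => edge u w
  | inl (inl u), inl (inr f) | inl (inr f), inl (inl u) => f \in link u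
  | inl (inl _), inr k | inr k, inl (inl _) => k == None
  | inl (inr _), inl (inr _) => false
  | inl (inr f), inr k | inr k, inl (inr f) => k != Some (Some f)
  | inr k, inr l => k != l
  end.

Lemma gadget_edge_sym : symmetric gadget_edge.
Proof. by move=> [[u|f]|k] [[w|g]|l] //=; [apply: edge_sym | rewrite eq_sym]. Qed.

Lemma gadget_edge_irr : irreflexive gadget_edge.
Proof. by move=> [[u|f]|k] //=; [apply: edge_irr | rewrite eqxx]. Qed.

Definition gadget : sgraph := SGraph gadget_edge_sym gadget_edge_irr.

Definition gadget_code (v : H) : {set gadget} :=
  copy v |: [set forced f | f in F].

Definition trace (y : gadget) : {set F} := [set f | forced f \in closed_neigh y].

Lemma traceE y : trace y = match y with
  | inl (inl u) => link u
  | inl (inr f) => [set f]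
  | inr (Some (Some f)) => [set~ f]
  | inr _ => setT
  end.
Proof.
case: y => [[u|f]|[[f|]|]]; apply/setP => g; rewrite !inE //= ?orbF //.
  by rewrite !inE.
by rewrite eq_sym.
Qed.

Lemma card_link v : #|link v| = 2.
Proof. by rewrite cards2. Qed.

Lemma link_inj : injective link.
Proof.
by move=> u v /setP/(_ (inl u)); rewrite !inE eqxx /= orbF => /esym/eqP[].
Qed.

Lemma trace_neq0 y : trace y != set0.
Proof.
have cF : #|F| = #|H| + 4 by rewrite card_sum card_ord.
rewrite -card_gt0 traceE; case: y => [[u|f]|[[f|]|]].
- by rewrite card_link.
- by rewrite cards1.
- by rewrite cardsC1 cF; lia.
- by rewrite cardsT cF; lia.
- by rewrite cardsT cF; lia.
Qed.

Let p : gadget := inr None.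
Let q : gadget := inr (Some None).

Lemma trace_eq y z : trace y = trace z ->
  [\/ y = z, y = p /\ z = q | y = q /\ z = p].
Proof.
have cF : #|F| = #|H| + 4 by rewrite card_sum card_ord.
rewrite !traceE => eq_t; have := congr1 (fun A : {set F} => #|A|) eq_t; move: eq_t.
case: y z => [[u|f]|[[f|]|]] [[w|g]|[[g|]|]];
  (* Cardinalities refute all pairs of different kinds except [p] against [q], which both have trace
     [setT]. *)
  rewrite ?card_link ?cards1 ?cardsC1 ?cardsT ?cF => eq_t; try lia; move=> _.
- by constructor 1; rewrite (link_inj eq_t).
- by constructor 1; rewrite (set1_inj eq_t).
- by constructor 1; rewrite (set1_inj (setC_inj eq_t)).
- by constructor 1.
- by constructor 3.
- by constructor 2.
- by constructor 1.
Qed.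

Lemma forced_in_gadget_code f v : forced f \in gadget_code v.
Proof. by rewrite inE imset_f ?orbT. Qed.

Lemma copy_in_gadget_code u v : (copy u \in gadget_code v) = (u == v).
Proof.
rewrite !inE; case: imsetP => [[f _]|_] //.
by rewrite orbF; apply/eqP/eqP => [[]|->].
Qed.

Lemma card_gadget_code v : #|gadget_code v| = #|F|.+1.
Proof.
rewrite cardsU1 card_imset => [|f g []//]; rewrite (_ : copy v \notin _) //.
by apply/imsetP => -[].
Qed.

Lemma id_gadget_code v : id_code (gadget_code v).
Proof.
apply: id_codeP => [y | y z eqN].
  have /set0Pn[f] := trace_neq0 y; rewrite inE => fy.
  by exists (forced f); rewrite ?forced_in_gadget_code.
have eq_t : trace y = trace z.
  by apply/setP => f; rewrite [LHS]in_set [RHS]in_set eqN // forced_in_gadget_code.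
have vS : copy v \in gadget_code v by rewrite copy_in_gadget_code.
(* The vertex [copy v] is adjacent to [p] but not to [q]. *)
by have [//|[eq_y eq_z]|[eq_y eq_z]] := trace_eq eq_t;
  have := eqN _ vS; rewrite eq_y eq_z !inE.
Qed.

Lemma id_code_sup (S : {set gadget}) : id_code S ->
  exists v, gadget_code v \subset S.
Proof.
move=> idS.
have [s sS] := id_code_sep idS (isT : p != q).
(* Only copies of vertices of [H] lie in exactly one of N[p] and N[q]. *)
case: s sS => [[v|f]|[[f|]|]] sS; rewrite !inE //= => _.
exists v; rewrite subUset sub1set sS; apply/subsetP => _ /imsetP[f _ ->].
have neq_aq : inr (Some (Some f)) != q by [].
have [s sfS] := id_code_sep idS neq_aq.
(* Only [forced f] distinguishes a_f from [q]: copies miss both, clique vertices lie in both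
   neighbourhoods. *)
case: s sfS => [[u|g]|[[g|]|]] sfS; rewrite !inE //=.
- by rewrite eqb_id negbK => /eqP[->].
- by rewrite (eq_sym (Some _)) orbN.
Qed.

(** The argument [v] witnesses that a code exists; for empty [H], [p] and [q] are twins and
    [gammaID] takes its default value. *)
Lemma gammaID_gadget (v : H) : gammaID gadget = #|F|.+1.
Proof.
have idv := id_gadget_code v.
apply/eqP; rewrite eqn_leq -{1}(card_gadget_code v) gammaID_le //=.
have [S /andP[idS /eqP<-]] := gammaID_attained idv.
by have [w /subset_leq_card] := id_code_sup idS; rewrite card_gadget_code.
Qed.

Lemma gadget_gammaID_setP (S : {set gadget}) :
  reflect (exists v, S == gadget_code v) (gammaID_set S).
Proof.
apply: (iffP andP) => [[idS /eqP cS] | [v /eqP->]]; last first.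
  by rewrite id_gadget_code card_gadget_code (gammaID_gadget v).
have [v sub] := id_code_sup idS; exists v.
by rewrite eq_sym eqEcard sub cS (gammaID_gadget v) card_gadget_code leqnn.
Qed.

(** Both codes contain every forced vertex, so the swapped vertices can only be [copy v] and
    [copy w]. *)
Lemma gadget_code_swap (v w : H) :
  [exists y in gadget_code v, exists z in gadget_code w,
     edge y z && (gadget_code w == (gadget_code v :\ y) :|: [set z])] = edge v w.
Proof.
apply/exists_inP/idP => [[y yv /exists_inP[z zw /andP[yz /eqP eqw]]] | vw]; last first.
  exists (copy v); first by rewrite copy_in_gadget_code.
  apply/exists_inP; exists (copy w); first by rewrite copy_in_gadget_code.
  rewrite /= vw /= setU1K 1?setUC //.
  by apply/imsetP => -[].
have y_notin : y \notin gadget_code w.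
  rewrite eqw !inE eqxx /=; apply: contraTneq yz => ->; by rewrite edge_irr.
have z_notin : z \notin gadget_code v.
  apply/negP => zv.
  (* Adding a [z] already present would leave a proper subset, yet all these codes have equal
     size. *)
  have : #|gadget_code w| < #|gadget_code v|.
    rewrite proper_card // properE; apply/andP; split.
      rewrite eqw subUset sub1set zv andbT; exact: subsetDl.
    by apply/subsetPn; exists y.
  by rewrite !card_gadget_code ltnn.
have swapped_copy u t x : x \in gadget_code u -> x \notin gadget_code t -> x = copy u.
  by rewrite !in_setU1 => /orP[/eqP-> // | ->]; rewrite orbT.
by move: yz; rewrite (swapped_copy _ _ _ yv y_notin) (swapped_copy _ _ _ zw z_notin).
Qed.

End Construction.

Theorem theorem5 (H : sgraph) :
  exists G : sgraph, sgraph_iso (gammaID_graph G) H.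
Proof.
exists (gadget H).
(* The boolean equality lets [sigW] choose [v] in the finite type [H], which turns the existence
   into a function. *)
have codeP (S : gammaID_graph (gadget H)) : {v : H | val S == gadget_code v}.
  exact/sigW/gadget_gammaID_setP/(valP S).
pose label S := sval (codeP S).
have labelP S : val S = gadget_code (label S) by apply/eqP/(svalP (codeP S)).
have isS (v : H) : gammaID_set (gadget_code v) by apply/gadget_gammaID_setP; exists v.
exists label; last by move=> A B; rewrite /= /gammaID_edge !labelP gadget_code_swap.
pose code v : gammaID_graph (gadget H) := exist (fun S => gammaID_set S) _ (isS v).
exists code => [S | v]; first by apply: val_inj; rewrite [RHS]labelP.
apply/esym/eqP; rewrite -copy_in_gadget_code -labelP.
by rewrite [val _]/= copy_in_gadget_code.
Qed.
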